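(* Let $d=2$ and let $\mu$ be a probability measure on the power set of $\mathcal{E}=\{e_1,e_2,-e_1,-e_2\}$. Suppose that $\mu(\{A: A\cap\{e_2,e_1\}\neq\emptyset\})=1$ and $\mu(\{A: A\cap\{e_2,-e_1\}\neq\emptyset\})=1$, and that $\mu(\{A: e\in A\})>0$ for every $e\in\mathcal{E}$ with $e\neq -e_2$. Let $x\in\mathbb{Z}^2$. Then: (a) $\nu$-almost surely one of the following occurs: (i) $\mathcal{B}_x$ is finite; (ii) $\mathcal{B}_x=\mathbb{Z}^2$; (iii) there exists an upper blocking function $W:\mathbb{Z}\to\mathbb{Z}$ such that $\mathcal{B}_x=W_{\le}$. (b) At most one of (ii), (iii) can have positive probability. (c) $\nu$-almost surely, for $x,y\in\mathbb{Z}^2$, if $|\mathcal{B}_x|=|\mathcal{B}_y|=\infty$ then $|\mathcal{B}_x\cap\mathcal{B}_y|=\infty$.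
   Context: Let $e_1,e_2$ be the standard basis of $\mathbb{Z}^2$, and write $x=(x^{[1]},x^{[2]})$. The environment $\mathcal{G}=(\mathcal{G}_x)_{x\in\mathbb{Z}^2}$ is a random element of $\mathcal{P}^{\mathbb{Z}^2}$, where $\mathcal{P}$ is the power set of $\mathcal{E}$, with law the product measure $\nu=\mu^{\otimes\mathbb{Z}^2}$ (so the $\mathcal{G}_x$ are i.i.d. with law $\mu$). Write $x\to y$ if there are $n\ge 0$ and $x=x_0,x_1,\dots,x_n=y$ with $x_{i+1}-x_i\in\mathcal{G}_{x_i}$ for $0\le i<n$ (such a path is called open). Let $\mathcal{B}_y=\{x\in\mathbb{Z}^2: x\to y\}$. For $w:\mathbb{Z}\to\mathbb{Z}$ let $w_\le=\{y: y^{[2]}\le w(y^{[1]})\}$ and $w_>=\{y: y^{[2]}>w(y^{[1]})\}$. $w$ is an upper blocking function for $\mathcal{G}$ if there is no open path in $\mathcal{G}$ from a point of $w_>$ to a point of $w_\le$. *)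

(* Defs.v *)
From HB Require Import structures.
From mathcomp Require Import all_boot all_order all_algebra.
From mathcomp Require Import all_classical all_reals all_analysis.

Set Implicit Arguments.
Unset Strict Implicit.
Unset Printing Implicit Defensive.

Import Order.TTheory GRing.Theory Num.Theory.
Local Open Scope classical_set_scope.
Local Open Scope ring_scope.

Notation Z2 := (int * int)%type.

Definition e1 : Z2 := (1, 0).
Definition e2 : Z2 := (0, 1).

Definition steps : seq Z2 := [:: e1; e2; - e1; - e2].

(* The power set of [steps], with the discrete sigma-algebra. *)
Definition stepset : Type := {set seq_sub steps}.
HB.instance Definition _ := Finite.on stepset.
HB.instance Definition _ := isPointed.Build stepset (finset.set0 : {set _}).
HB.instance Definition _ := @isMeasurable.Build default_measure_display
  stepset discrete_measurable discrete_measurable0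
  discrete_measurableC discrete_measurableU.

(* An element of the power set, seen as a subset of Z^2. *)
Definition dirs (A : stepset) : set Z2 :=
  [set ssval s | s in [set s : seq_sub steps | s \in (A : {set seq_sub steps})]].

(* Environments carry the product sigma-algebra, i.e. the one generated by
   the coordinate maps [fun G => G x]. *)
Definition coordinate_events : set (set (Z2 -> stepset)) :=
  [set C | exists x : Z2, exists2 B : set stepset,
     measurable B & C = [set G | B (G x)]].
Definition environment : Type := g_sigma_algebraType coordinate_events.

(* [nu] is the product of copies of [mu]: the value of the product measure on
   finite-dimensional rectangles determines it uniquely, since these form a
   pi-system generating the product sigma-algebra. *)
Definition is_product_measure (R : realType) (mu : probability stepset R)
    (nu : probability environment R) : Prop :=
  forall (s : seq Z2) (B : Z2 -> set stepset),
    uniq s -> (forall x, measurable (B x)) ->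
    nu [set G : environment | forall x, x \in s -> B x (G x)] =
    (\prod_(x <- s) fine (mu (B x)))%:E.

Definition open_path (G : environment) (n : nat) (p : nat -> Z2) : Prop :=
  forall i, (i < n)%N -> dirs (G (p i)) (p i.+1 - p i).

Definition reaches (G : environment) (x y : Z2) : Prop :=
  exists (n : nat) (p : nat -> Z2), [/\ p 0%N = x, p n = y & open_path G n p].

Definition backward_cluster (G : environment) (y : Z2) : set Z2 :=
  [set x | reaches G x y].

Definition below (w : int -> int) : set Z2 := [set y | y.2 <= w y.1].
Definition above (w : int -> int) : set Z2 := [set y | w y.1 < y.2].

Definition upper_blocking (G : environment) (w : int -> int) : Prop :=
  ~ exists x y : Z2, [/\ above w x, below w y & reaches G x y].

(* Main.v *)
Require Import Defs.
From mathcomp Require Import all_boot all_order all_algebra.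
From mathcomp Require Import all_classical all_reals all_analysis.
From mathcomp Require Import zify lra.

Import Order.TTheory GRing.Theory Num.Theory.
Import numFieldNormedType.Exports.
Local Open Scope classical_set_scope.
Local Open Scope ring_scope.

(** Almost surely every site has an upward arrow or both horizontal ones, and
    along every axis ray each direction other than [- e2] occurs; the rest of
    (a) and (c) is deterministic. Let [B] be the cluster of [x]. From a point
    outside [B] two staircases, up-right and up-left, stay outside [B], and [B]
    cannot cross them; hence [B] meets every column in an interval. If some
    column met by [B] had a lowest point, the site below it would have no upward
    arrow, hence both horizontal ones, so the neighbouring columns met by [B]
    would have their lowest point at the same height. As each row contains
    upward arrows on both sides, [B] would meet finitely many columns only, and
    then be finite. So an infinite [B] is unbounded below in every column, and it
    is unbounded above either in every column or in none.

    For (b): if [B] is the region below a graph then it contains [x - n e2] for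
    every [n], so none of these points has the whole plane as its cluster. As the
    vertical shift is mixing, the two events would otherwise occur together
    for [x] and [x - n e2], [n] large. *)

(** * Lattice steps and regular environments *)

Lemma addZ2 (a b c d : int) : (a, b) + (c, d) = (a + c, b + d) :> Z2.
Proof. by []. Qed.

Lemma dirs_steps A d : dirs A d -> d \in steps.
Proof. by case=> s _ <-; exact: valP s. Qed.

Lemma stepsP d : d \in steps ->
  [\/ d = (1, 0), d = (0, 1), d = (-1, 0) | d = (0, -1)].
Proof.
rewrite !inE => /or4P[] /eqP ->;
  by [apply: Or41|apply: Or42|apply: Or43|apply: Or44].
Qed.

(** The first clause joins the two almost sure hypotheses: a site without [e2] can satisfy both only
    by having [e1] and [- e1]. The second starts a ray at every [z], so it yields infinitely many
    occurrences along each ray. *)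
Definition regular (G : environment) : Prop :=
  (forall z, dirs (G z) e2 \/ dirs (G z) e1 /\ dirs (G z) (- e1)) /\
  (forall d v z, d \in steps -> d <> - e2 -> v \in steps ->
     exists n, dirs (G (z + v *+ n)) d).

Lemma nextto_ind (P : int -> Prop) :
  (forall a t : int, t = 1 \/ t = -1 -> P a -> P (a + t)) ->
  forall a a', P a -> P a'.
Proof.
move=> IH a a' Pa.
have H t (n : nat) : t = 1 \/ t = -1 -> P (a + t * n%:Z).
  move=> ht; elim: n => [|n Pn]; first by rewrite mulr0 addr0.
  rewrite (_ : _ * _ = t * n%:Z + t) ?addrA; first exact: IH.
  by case: ht => ->; lia.
have [h|h] : a <= a' \/ a' <= a by lia.
  by rewrite (_ : a' = a + 1 * `|a' - a|%N%:Z); [apply: H; left|lia].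
by rewrite (_ : a' = a + (-1) * `|a' - a|%N%:Z); [apply: H; right|lia].
Qed.

(** * Open paths and reachability *)

Lemma reaches_refl G y : reaches G y y.
Proof. by exists 0%N, (fun=> y); split. Qed.

Lemma reaches_step G z d y : dirs (G z) d -> reaches G (z + d) y -> reaches G z y.
Proof.
move=> zd [n [p [p0 pn op]]].
exists n.+1, (fun i => if i is j.+1 then p j else z); split=> // -[|i] /= lti.
  by rewrite p0 addrAC subrr add0r.
exact: op.
Qed.

(** Induction backwards from the endpoint of a path, putting one arrow in front at a time. The
    premise [reaches G (z + d) y] records that the next site is in the cluster as well. *)
Lemma reaches_ind G (Q : Z2 -> Prop) y :
    Q y ->
    (forall z d, dirs (G z) d -> reaches G (z + d) y -> Q (z + d) -> Q z) ->
  forall z, reaches G z y -> Q z.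
Proof.
move=> Qy IH z [n [p [p0 pn op]]].
suff H k : (k <= n)%N -> reaches G (p (n - k)%N) y /\ Q (p (n - k)%N).
  by case: (H n (leqnn n)) => _; rewrite subnn p0.
elim: k => [_|k IHk ltkn]; first by rewrite subn0 pn; split=> //; exact: reaches_refl.
have [r q] := IHk (ltnW ltkn).
have zd : dirs (G (p (n - k.+1)%N)) (p (n - k)%N - p (n - k.+1)%N).
  by rewrite (_ : (n - k = (n - k.+1).+1)%N) ; [apply: op|]; lia.
have e : p (n - k.+1)%N + (p (n - k)%N - p (n - k.+1)%N) = p (n - k)%N.
  by rewrite addrC subrK.
by split; [apply: (reaches_step _ _ _ _ zd)|apply: (IH _ _ zd)]; rewrite e.
Qed.

Lemma reaches_trans G a b c : reaches G a b -> reaches G b c -> reaches G a c.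
Proof.
move=> ab bc; elim/reaches_ind: a / ab => // z d zd _ H; exact: reaches_step zd H.
Qed.

(** A backward cluster contains all predecessors of its sites, so no open path enters it from
    outside. *)
Lemma below_blocking G W x : backward_cluster G x = below W -> upper_blocking G W.
Proof.
move=> BW [y [z [ay bz yz]]].
have : below W y by rewrite -BW; apply: reaches_trans yz _; rewrite -BW in bz.
by move: ay; rewrite /above /below /= ltNge => /negP.
Qed.

(** * Geometry of a single backward cluster in a regular environment *)

Section BackwardCluster.
Variables (G : environment) (x : Z2).
Local Notation B := (backward_cluster G x).

Lemma cluster_up a b : dirs (G (a, b)) e2 -> B (a, b + 1) -> B (a, b).
Proof.
move=> d Bd; apply: (reaches_step _ _ _ _ d).
by rewrite /GRing.add /= /add_pair /= addr0.
Qed.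

Lemma cluster_right a b : dirs (G (a, b)) e1 -> B (a + 1, b) -> B (a, b).
Proof.
move=> d Bd; apply: (reaches_step _ _ _ _ d).
by rewrite /GRing.add /= /add_pair /= addr0.
Qed.

Lemma cluster_left a b : dirs (G (a, b)) (- e1) -> B (a - 1, b) -> B (a, b).
Proof.
move=> d Bd; apply: (reaches_step _ _ _ _ d).
by rewrite /GRing.add /= /add_pair /= addr0.
Qed.

Hypothesis regG : regular G.

(** The walk from [y] that climbs when it can and otherwise moves by [s], given by the sites it
    visits. For [s] equal to 1 or -1 regularity makes every move follow an open arrow. *)
Inductive staircase (s : int) (y : Z2) : int -> int -> Prop :=
| staircase_start : staircase s y y.1 y.2
| staircase_up a b :
    staircase s y a b -> dirs (G (a, b)) e2 -> staircase s y a (b + 1)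
| staircase_side a b :
    staircase s y a b -> ~ dirs (G (a, b)) e2 -> staircase s y (a + s) b.

(** Each move follows an open arrow, so entering the cluster would put the previous site in it. *)
Lemma staircase_avoids s y a b : s = 1 \/ s = -1 ->
  ~ B y -> staircase s y a b -> ~ B (a, b).
Proof.
move=> hs nBy; elim=> {a b} [|a b _ nB up|a b _ nB nup]; first by case: (y) nBy.
  by move=> H; apply: nB; exact: cluster_up.
have [//|[r l]] := regG.1 (a, b).
by case: hs => -> H; apply: nB; [exact: cluster_right|exact: cluster_left].
Qed.

(** If [(a, b + k)] is in the cluster, a staircase avoiding the cluster cannot climb that far and
    must have turned sideways below that height. *)
Lemma staircase_next s y a b (k : nat) : staircase s y a b ->
  staircase s y a (b + k%:Z) \/
  exists2 c, staircase s y (a + s) c & b <= c < b + k%:Z.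
Proof.
move=> st; elim: k => [|k [IH|[c stc hc]]]; first by left; rewrite addr0.
  have [up|nup] := pselect (dirs (G (a, b + k%:Z)) e2).
    left; rewrite (_ : b + k.+1%:Z = b + k%:Z + 1); last by lia.
    exact: staircase_up.
  by right; exists (b + k%:Z); [exact: staircase_side|lia].
by right; exists c => //; lia.
Qed.

Lemma staircase_prev s y a b : staircase s y a b ->
  a = y.1 /\ y.2 <= b \/ exists2 c, staircase s y (a - s) c & c <= b.
Proof.
elim=> {a b} [|a b _ [[-> h]|[c stc hc]] _|a b st _ _]; first by left.
- by left; split=> //; lia.
- by right; exists c => //; lia.
- by right; exists b; rewrite ?addrK.
Qed.

(* The region above the two staircases from [y]. *)
Definition wedge (y z : Z2) : Prop :=
  exists s b, [/\ s = 1 \/ s = -1, staircase s y z.1 b & b <= z.2].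

(** Moving away from [y], the staircase cannot climb through [(a, b)], so it enters the next column
    no higher than [b]. Moving back, it came from a lower site of that column, or column [a] is that
    of [y] and the opposite staircase takes over. *)
Lemma wedge_side y (a b t : int) : ~ B y -> t = 1 \/ t = -1 ->
  B (a, b) -> wedge y (a, b) -> wedge y (a + t, b).
Proof.
move=> nBy ht Bab [s [c [hs /= st lecb]]].
have next s' c' : s' = 1 \/ s' = -1 -> staircase s' y a c' -> c' <= b ->
    wedge y (a + s', b).
  move=> hs' st' le'.
  have [/=|[c'' st'' h'']] := staircase_next _ _ _ _ (`|b - c'|%N) st'.
    rewrite (_ : c' + _ = b); last by lia.
    by move/(staircase_avoids _ _ _ _ hs' nBy).
  by exists s', c''; split => //=; lia.
have [->|e] : t = s \/ t = - s by lia.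
  exact: next st lecb.
have [[ea hc]|[c' st' hc]] := staircase_prev _ _ _ _ st.
  rewrite e; apply: (next _ y.2); [lia|rewrite ea; exact: staircase_start|lia].
by exists s, c'; split=> //=; [rewrite e|lia].
Qed.

(** Along an open path inside the cluster, membership in the wedge never changes: horizontal steps
    are covered by [wedge_side] in both directions, and a vertical step across the boundary would
    need a cluster site on a staircase. *)
Lemma wedge_cluster y z : ~ B y -> B z -> (wedge y z <-> wedge y x).
Proof.
move=> nBy; elim/reaches_ind: z / => // -[a b] d zd Bzd.
have Bab : B (a, b) by exact: reaches_step zd Bzd.
move=> <-; have [e|e|e|e] := stepsP _ (dirs_steps _ _ zd);
  rewrite {d zd}e addZ2 ?addr0 in Bzd *.
- split; first by apply: wedge_side => //; left.
  move=> /(wedge_side _ _ _ (-1) nBy); rewrite addrK; apply => //; by right.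
- split=> -[s [c [hs /= st lec]]]; first by exists s, c; split=> //=; lia.
  exists s, c; split=> //=.
  have : c <> b + 1 by move=> ec; apply: (staircase_avoids _ _ _ _ hs nBy st); rewrite ec.
  by lia.
- split; first by apply: wedge_side => //; right.
  move=> /(wedge_side _ _ _ 1 nBy); rewrite subrK; apply => //; by left.
- split=> -[s [c [hs /= st lec]]]; last by exists s, c; split=> //=; lia.
  exists s, c; split=> //=.
  have : c <> b by move=> ec; apply: (staircase_avoids _ _ _ _ hs nBy st); rewrite ec.
  by lia.
Qed.

Lemma staircase_ge s y a b : staircase s y a b -> y.2 <= b.
Proof. by elim=> {a b} [|a b _ IH _|//]; lia. Qed.

(** Take the wedge of a missing site [(a, c)]: the upper site lies in it, hence so does the lower
    one, but staircases never descend below height [c]. *)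
Lemma column_interval (a b c d : int) : b <= c <= d -> B (a, b) -> B (a, d) -> B (a, c).
Proof.
move=> hbcd Bb Bd; apply: contrapT => nBc.
have wd : wedge (a, c) (a, d).
  exists 1, c; split; [by left|exact: staircase_start|by case/andP: hbcd].
have [s [c' [hs /= st le]]] : wedge (a, c) (a, b).
  by rewrite (wedge_cluster _ _ nBc Bb) -(wedge_cluster _ _ nBc Bd).
have /= h := staircase_ge _ _ _ _ st.
have e : c = b by lia.
by apply: nBc; rewrite e.
Qed.

(** An open path from [z] to [x] has to cross from column [a + 1] to column [a]; both ends of that
    horizontal step are in the cluster. *)
Lemma columns_overlap_right (a : int) (z : Z2) : x.1 <= a -> a < z.1 -> B z ->
  exists c, B (a, c) /\ B (a + 1, c).
Proof.
move=> le_xa + Bz; elim/reaches_ind: z / Bz; first by lia.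
move=> [a' b] d zd Bzd IH /= lt_aa'.
have Bab : B (a', b) by exact: reaches_step zd Bzd.
have [e|e|e|e] := stepsP _ (dirs_steps _ _ zd);
  rewrite {d zd}e addZ2 ?addr0 /= in Bzd IH; try by apply: IH; lia.
have [e|ne] : a' - 1 = a \/ a < a' - 1 by lia.
  by exists b; rewrite -e subrK.
exact: IH.
Qed.

Lemma columns_overlap_left (a : int) (z : Z2) : a < x.1 -> z.1 <= a -> B z ->
  exists c, B (a, c) /\ B (a + 1, c).
Proof.
move=> lt_ax + Bz; elim/reaches_ind: z / Bz; first by lia.
move=> [a' b] d zd Bzd IH /= le_a'a.
have Bab : B (a', b) by exact: reaches_step zd Bzd.
have [e|e|e|e] := stepsP _ (dirs_steps _ _ zd);
  rewrite {d zd}e addZ2 ?addr0 /= in Bzd IH; try by apply: IH; lia.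
have [e|ne] : a' = a \/ a' + 1 <= a by lia.
  by exists b; rewrite -e.
exact: IH.
Qed.

(* The site below the lowest point of a column has no upward arrow, hence both
   horizontal ones, so its neighbours are outside the cluster as well. *)
Lemma bottom_nextto (a b c t : int) : t = 1 \/ t = -1 ->
  B (a, b) -> ~ B (a, b - 1) -> B (a, c) -> B (a + t, c) ->
  B (a + t, b) /\ ~ B (a + t, b - 1).
Proof.
have hside a' b' t' : t' = 1 \/ t' = -1 -> ~ B (a', b') -> B (a', b' + 1) ->
    ~ B (a' + t', b').
  move=> ht nB Bu H; apply: nB; have [u|[r l]] := regG.1 (a', b').
    exact: cluster_up.
  by case: ht H => -> H; [exact: cluster_right|exact: cluster_left].
move=> ht Bb nBb Bc Btc.
have le_bc : b <= c.
  apply: contrapT => h; apply: nBb; apply: (column_interval _ c _ b) => //; lia.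
have nBt : ~ B (a + t, b - 1) by apply: hside; rewrite ?subrK.
split=> //; apply: contrapT => nBtb.
(* Take the first cluster site of column [a + t] at height [b] or more. Were it above [b], the site
   just below it would lack an upward arrow and force a site of column [a] between heights [b] and
   [c] out of the cluster. *)
have hex : exists k, B (a + t, b + k%:Z).
  by exists `|c - b|%N; rewrite (_ : b + _ = c) //; lia.
pose P k := `[<B (a + t, b + k%:Z)>].
have exP : exists k, P k by case: hex => k ?; exists k; apply/asboolP.
case: (ex_minnP exP) => -[|k] /asboolP Bk kmin.
  by apply: nBtb; rewrite addr0 in Bk.
have nBk : ~ B (a + t, b + k%:Z).
  by move=> /asboolP/kmin; lia.
have := hside (a + t) (b + k%:Z) (- t) ltac:(lia) nBk.
rewrite -addrA (_ : k%:Z + 1 = k.+1%:Z) ?addrK; last by lia.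
move=> /(_ Bk); apply; apply: (column_interval _ b _ c) => //.
have : (k < `|c - b|)%N by apply: kmin; apply/asboolP; rewrite (_ : b + _ = c) //; lia.
lia.
Qed.

(** * Vertical extent of the columns and the trichotomy *)

Definition unbounded_below (a : int) := forall b, exists2 c, c <= b & B (a, c).
Definition unbounded_above (a : int) := forall b, exists2 c, b <= c & B (a, c).

Lemma regular_below d (a b : int) : d \in steps -> d <> - e2 ->
  exists2 c, c <= b & dirs (G (a, c)) d.
Proof.
move=> ds de2; have [n] := regG.2 d (- e2) (a, b) ds de2 isT.
have -> : (a, b) + - e2 *+ n = (a, b - n%:Z).
  elim: n => [|n IH]; first by rewrite mulr0n addr0; congr pair; lia.
  rewrite mulrSr addrA IH; congr pair; rewrite /=; lia.
by exists (b - n%:Z) => //; lia.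
Qed.

Lemma regular_above d (a b : int) : d \in steps -> d <> - e2 ->
  exists2 c, b <= c & dirs (G (a, c)) d.
Proof.
move=> ds de2; have [n] := regG.2 d e2 (a, b) ds de2 isT.
have -> : (a, b) + e2 *+ n = (a, b + n%:Z).
  elim: n => [|n IH]; first by rewrite mulr0n addr0; congr pair; lia.
  rewrite mulrSr addrA IH; congr pair; rewrite /=; lia.
by exists (b + n%:Z) => //; lia.
Qed.

Lemma regular_row (a b t : int) : t = 1 \/ t = -1 ->
  exists n : nat, dirs (G (a + t * n%:Z, b)) e2.
Proof.
move=> ht; have tse : (t, 0) \in steps by case: ht => ->.
have [n] := regG.2 e2 (t, 0) (a, b) isT ltac:(by []) tse.
have -> : (a, b) + (t, 0) *+ n = (a + t * n%:Z, b); last by exists n.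
elim: n => [|n IH]; first by rewrite mulr0n addr0 mulr0 addr0.
rewrite mulrSr addrA IH; congr pair; rewrite /= ?addr0 //; case: ht => ->; lia.
Qed.

Lemma cluster_side (a b t : int) : t = 1 \/ t = -1 ->
  dirs (G (a + t, b)) (- t, 0) -> B (a, b) -> B (a + t, b).
Proof.
by move=> ht d Bab; apply: (reaches_step _ _ _ _ d); rewrite addZ2 addrK addr0.
Qed.

Lemma side_step (t : int) : t = 1 \/ t = -1 ->
  (- t, 0) \in steps /\ (- t, 0) <> - e2 :> Z2.
Proof. by case=> ->. Qed.

(** The neighbouring column has arrows pointing back to column [a] at arbitrarily low heights, and
    these end in the cluster because its part in column [a] is an interval. *)
Lemma unbounded_below_nextto (a t : int) : t = 1 \/ t = -1 ->
  unbounded_below a -> unbounded_below (a + t).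
Proof.
move=> ht ua b; have [c0 h0 B0] := ua b; have [ts te] := side_step _ ht.
have [c h d] := regular_below _ (a + t) c0 ts te.
have [c1 h1 B1] := ua c; exists c; first by lia.
by apply: cluster_side => //; apply: (column_interval _ c1 _ c0) => //; lia.
Qed.

Lemma unbounded_above_nextto (a t : int) : t = 1 \/ t = -1 ->
  unbounded_above a -> unbounded_above (a + t).
Proof.
move=> ht ua b; have [c0 h0 B0] := ua b; have [ts te] := side_step _ ht.
have [c h d] := regular_above _ (a + t) c0 ts te.
have [c1 h1 B1] := ua c; exists c; first by lia.
by apply: cluster_side => //; apply: (column_interval _ c0 _ c1) => //; lia.
Qed.

Lemma not_unbounded_below (a : int) : ~ unbounded_below a ->
  exists b, forall c, B (a, c) -> b <= c.
Proof.
move=> /existsNP[b H]; exists b => c Bc.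
by apply: contrapT => h; apply: H; exists c => //; lia.
Qed.

Lemma not_unbounded_above (a : int) : ~ unbounded_above a ->
  exists b, forall c, B (a, c) -> c <= b.
Proof.
move=> /existsNP[b H]; exists b => c Bc.
by apply: contrapT => h; apply: H; exists c => //; lia.
Qed.

Lemma bottom_exists (a c : int) : ~ unbounded_below a -> B (a, c) ->
  exists b, B (a, b) /\ ~ B (a, b - 1).
Proof.
move=> /not_unbounded_below[m hm] Bc.
pose P k := `[<B (a, m + k%:Z)>].
have exP : exists k, P k.
  exists `|c - m|%N; apply/asboolP; rewrite (_ : m + _ = c) //.
  by have := hm _ Bc; lia.
case: (ex_minnP exP) => k /asboolP Bk kmin; exists (m + k%:Z); split=> //.
move=> Bk1; have := hm _ Bk1 => hk.
(* The lower bound [m] gives [k >= 1], so [k.-1] is a true predecessor. *)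
suff : (k <= k.-1)%N by lia.
by apply: kmin; apply/asboolP; rewrite (_ : m + _ = m + k%:Z - 1) //; lia.
Qed.

Lemma top_exists (a : int) : unbounded_below a -> ~ unbounded_above a ->
  exists w, forall c, B (a, c) <-> c <= w.
Proof.
move=> ua /not_unbounded_above[m hm]; have [b0 _ B0] := ua 0.
pose P k := `[<B (a, m - k%:Z)>].
have exP : exists k, P k.
  exists `|m - b0|%N; apply/asboolP; rewrite (_ : m - _ = b0) //.
  by have := hm _ B0; lia.
case: (ex_minnP exP) => k /asboolP Bk kmin; exists (m - k%:Z) => c; split=> [Bc|h].
  have := hm _ Bc => hc.
  suff : (k <= `|m - c|)%N by lia.
  by apply: kmin; apply/asboolP; rewrite (_ : m - _ = c) //; lia.
have [c1 h1 B1] := ua c.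
by apply: (column_interval _ c1 _ (m - k%:Z)) => //; lia.
Qed.

Lemma finite_set_int (l h : int) : finite_set [set a : int | l <= a <= h].
Proof.
apply: (@sub_finite_set _ _ ((fun k : nat => l + k%:Z) @` `I_(`|h - l|.+1))).
  by move=> a /= ?; exists `|a - l|%N; rewrite /=; lia.
exact/finite_image/finite_II.
Qed.

(** Otherwise the lowest point keeps its height [b] in all columns on that side, while row [b - 1]
    has an upward arrow there, which leads into the cluster from a site outside it. *)
Lemma bounded_side_exists (t : int) : t = 1 \/ t = -1 ->
  ~ unbounded_below x.1 ->
  exists n : nat, forall z, B z -> t * (z.1 - x.1) < n%:Z.
Proof.
move=> ht nu; have Bx : B x by exact: reaches_refl.
have [b [Bb nBb]] : exists b, B (x.1, b) /\ ~ B (x.1, b - 1).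
  by apply: (bottom_exists _ x.2) => //; case: (x) Bx.
apply: contrapT => /forallNP H.
have {H} reach n : exists2 z, B z & n%:Z <= t * (z.1 - x.1).
  have /existsNP[z /not_implyP[Bz h]] := H n; exists z => //.
  by rewrite leNgt; apply/negP.
have S (n : nat) : B (x.1 + t * n%:Z, b) /\ ~ B (x.1 + t * n%:Z, b - 1).
  elim: n => [|n [Bn nBn]]; first by rewrite mulr0 addr0.
  have [z Bz hz] := reach n.+1.
  have [c [Bc Bc']] : exists c, B (x.1 + t * n%:Z, c) /\ B (x.1 + t * n%:Z + t, c).
    case: ht hz => -> hz.
      by rewrite mul1r; apply: (columns_overlap_right _ z) => //; lia.
    (* The overlap is indexed by the left column of the pair, which is here the farther one. *)
    have [|c [H1 H2]] := columns_overlap_left (x.1 - n.+1%:Z) z ltac:(lia) _ Bz.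
      by lia.
    exists c; rewrite (_ : x.1 + -1 * n%:Z = x.1 - n.+1%:Z + 1); last by lia.
    by rewrite addrK.
  rewrite (_ : x.1 + t * n.+1%:Z = x.1 + t * n%:Z + t).
    exact: (bottom_nextto _ _ c).
  by case: ht => ->; lia.
have [n up] := regular_row x.1 (b - 1) t ht.
by have [Bn] := S n; apply; apply: cluster_up => //; rewrite subrK.
Qed.

Lemma infinite_unbounded_below : infinite_set B -> forall a, unbounded_below a.
Proof.
move=> infB; apply: contrapT => /existsNP[a0 nu0].
have nu a : ~ unbounded_below a.
  by move=> ua; apply: nu0; apply: (nextto_ind unbounded_below _ a) => //; exact: unbounded_below_nextto.
have [n hn] := bounded_side_exists 1 (or_introl erefl) (nu x.1).
have [m hm] := bounded_side_exists (-1) (or_intror erefl) (nu x.1).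
(* Column [x.1 + n] lies beyond the bound and is empty, while unboundedness above would spread to
   it. *)
have nuA a : ~ unbounded_above a.
  move=> ua.
  have /(_ 0)[c _ /hn /=] : unbounded_above (x.1 + n%:Z).
    by apply: (nextto_ind unbounded_above _ a) => //; exact: unbounded_above_nextto.
  by lia.
have /choice[lo hlo] a := not_unbounded_below _ (nu a).
have /choice[hi hhi] a := not_unbounded_above _ (nuA a).
apply: infB; apply: (@sub_finite_set _ _
  (\bigcup_(a in [set a | x.1 - m%:Z <= a <= x.1 + n%:Z])
     (pair a @` [set c | lo a <= c <= hi a]))).
  move=> [a c] Bac; exists a.
    by have := hn _ Bac; have := hm _ Bac => /=; lia.
  by exists c => //=; rewrite hlo //= hhi.
apply: bigcup_finite; first exact: finite_set_int.
by move=> a _; apply: finite_image; exact: finite_set_int.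
Qed.

Lemma infinite_cluster_low : infinite_set B ->
  forall a, exists w, forall c, c <= w -> B (a, c).
Proof.
move=> infB a; have ua := infinite_unbounded_below infB a.
have [w _ Bw] := ua 0; exists w => c h; have [c' h' B'] := ua c.
by apply: (column_interval _ c' _ w) => //; lia.
Qed.

Lemma cluster_trichotomy :
  [\/ finite_set B, B = setT | exists2 W, upper_blocking G W & B = below W].
Proof.
have [|infB] := pselect (finite_set B); first by move=> ?; apply: Or31.
have ub := infinite_unbounded_below infB.
have [[a0 ua0]|nua] := pselect (exists a, unbounded_above a).
  apply: Or32; rewrite -subTset => -[a b] _.
  have [c hc Bc] := ub a b.
  have [d hd Bd] : exists2 d, b <= d & B (a, d).
    by apply: (nextto_ind unbounded_above _ a0) => //; exact: unbounded_above_nextto.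
  by apply: (column_interval _ c _ d) => //; lia.
have /choice[W hW] a : exists w, forall c, B (a, c) <-> c <= w.
  by apply: top_exists => // ua; apply: nua; exists a.
have BW : B = below W.
  by apply/seteqP; split => -[a b]; rewrite /below /= hW.
by apply: Or33; exists W => //; exact: below_blocking BW.
Qed.

End BackwardCluster.

(** Each of the two clusters contains a downward half-line of column 0, and two such half-lines
    share one. *)
Lemma infinite_clusters_meet G y z : regular G ->
  infinite_set (backward_cluster G y) -> infinite_set (backward_cluster G z) ->
  infinite_set (backward_cluster G y `&` backward_cluster G z).
Proof.
move=> regG infy infz.
have [w hw] := infinite_cluster_low _ _ regG infy 0.
have [v hv] := infinite_cluster_low _ _ regG infz 0.
pose f (k : nat) : Z2 := (0, Num.min w v - k%:Z).
have injf : injective f by move=> k l [] /addrI/oppr_inj[].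
apply: (@sub_infinite_set _ (range f)).
  move=> _ [k _ <-]; split; [apply: hw|apply: hv]; lia.
by apply/infiniteP; rewrite (card_le_eqr (inj_card_eq (in2W injf))).
Qed.

(** * Asymptotic independence from a sequence of events *)

Section AsymptoticIndependence.
Context d (T : measurableType d) (R : realType) (P : probability T R).
Local Notation p A := (fine (P A)).

Lemma fine_probabilityD A B : measurable A -> measurable B -> B `<=` A ->
  p (A `\` B) = p A - p B.
Proof.
move=> mA mB BA; rewrite measureD // ?setIidr // ?fineB // ?fin_num_measure //.
by rewrite ltey_eq fin_num_measure.
Qed.

Lemma fine_probability_le A B : measurable A -> measurable B -> A `<=` B ->
  p A <= p B.
Proof.
by move=> mA mB AB; rewrite fine_le ?fin_num_measure // le_measure ?inE.
Qed.

(** For increasing unions the error made by replacing the union by [F m] is at most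
    [p (\bigcup_n F n) - p (F m)] uniformly in [n], so the two limits can be exchanged. *)
Lemma asymptotic_independence_lambda_system (K : nat -> set T) (c : R) :
  (forall n, measurable (K n)) -> p (K n) @[n --> \oo] --> c ->
  lambda_system setT
    [set A | measurable A /\ p (A `&` K n) @[n --> \oo] --> p A * c].
Proof.
move=> mK Kc; split => //.
- split=> //; under eq_fun do rewrite setTI.
  by rewrite probability_setT /= mul1r.
- move=> A B BA [mA cA] [mB cB]; split; first exact: measurableD.
  rewrite fine_probabilityD // mulrBl.
  have -> : (fun n => p ((A `\` B) `&` K n)) =
      (fun n => p (A `&` K n) - p (B `&` K n)).
    apply/funext => n; rewrite -fine_probabilityD; last exact: setSI.
    + by congr (fine (P _)); apply/seteqP; split=> t /=; tauto.
    + exact: measurableI.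
    + exact: measurableI.
  exact: cvgB.
- move=> F ndF HF; have mF n := (HF n).1.
  have mU : measurable (\bigcup_n F n) by exact: bigcup_measurable.
  split=> //; apply/cvgrPdist_le => e e0.
  have cF : p (F n) @[n --> \oo] --> p (\bigcup_n F n).
    apply: fine_cvg; rewrite fineK ?fin_num_measure //.
    exact: nondecreasing_cvg_mu.
  (* As a limit of probabilities [c] is in [0, 1], so multiplying by [c] does not enlarge the
     error. *)
  have c0 : 0 <= c.
    apply: (cvgr_to_ge Kc); near=> n; exact: fine_ge0.
  have c1 : c <= 1.
    apply: (cvgr_to_le Kc); near=> n.
    by rewrite -[1]/(fine 1%E) fine_le ?fin_num_measure // probability_le1.
  have e3 : 0 < e / 3 by lra.
  move/cvgrPdist_le : cF => /(_ _ e3)[m _ Hm].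
  have {Hm} hm := Hm m (leqnn m).
  near=> n.
  have hn : `|p (F m) * c - p (F m `&` K n)| <= e / 3.
    by near: n; have /cvgrPdist_le := (HF m).2; exact.
  have FU : F m `<=` \bigcup_n F n by exact: bigcup_sup.
  have mI A : measurable A -> measurable (A `&` K n) by move=> ?; exact: measurableI.
  have h1 : p (F m `&` K n) <= p (\bigcup_n F n `&` K n).
    by apply: fine_probability_le; [exact: mI|exact: mI|exact: setSI].
  have h2 : p (\bigcup_n F n `&` K n) - p (F m `&` K n) <=
            p (\bigcup_n F n) - p (F m).
    rewrite -!fine_probabilityD //; [|exact: mI|exact: mI|exact: setSI].
    apply: fine_probability_le; [apply: measurableD; exact: mI|exact: measurableD|].
    by move=> t [[Ut Kt] nFt]; split=> // Ft; apply: nFt.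
  have h3 : p (F m) <= p (\bigcup_n F n) by exact: fine_probability_le.
  move: hm hn; rewrite !ler_norml => /andP[_ hm] /andP[hn1 hn2].
  by apply/andP; split; nra.
Unshelve. all: by end_near. Qed.

(** By the pi-lambda theorem, a generating pi-system is enough. *)
Lemma asymptotic_independence (C : set (set T)) (K : nat -> set T) (c : R) :
  @measurable _ T = <<s C >> -> setI_closed C ->
  (forall n, measurable (K n)) -> p (K n) @[n --> \oo] --> c ->
  (forall A, C A -> p (A `&` K n) @[n --> \oo] --> p A * c) ->
  forall A, measurable A -> p (A `&` K n) @[n --> \oo] --> p A * c.
Proof.
move=> CE CI mK Kc HC A; rewrite CE => sA.
have := lambda_system_subset CI (asymptotic_independence_lambda_system _ _ mK Kc).
move=> /(_ _ _ _ sA)[]// B CB; split; last exact: HC.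
by rewrite CE; exact: sub_gen_smallest.
Qed.

End AsymptoticIndependence.

(** * The product measure, its shifts and mixing *)

Section Environments.
Context (R : realType) (mu : probability stepset R) (nu : probability environment R).
Hypothesis nu_product : is_product_measure mu nu.

Lemma measurable_coordinate (z : Z2) (B : set stepset) :
  measurable [set G : environment | B (G z)].
Proof. by apply: sub_sigma_algebra; exists z, B. Qed.

Definition cylinder (s : seq Z2) (B : Z2 -> set stepset) : set environment :=
  [set G | forall z, z \in s -> B z (G z)].

Lemma measurable_cylinder s B : measurable (cylinder s B).
Proof.
elim: s => [|z s IH].
  by rewrite (_ : cylinder _ _ = setT) //; apply/seteqP; split.
rewrite (_ : cylinder _ _ = [set G : environment | B z (G z)] `&` cylinder s B).
  by apply: measurableI => //; exact: measurable_coordinate.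
apply/seteqP; split=> [G H|G [H1 H2] y].
  by split=> [|y ys]; apply: H; rewrite inE ?eqxx ?ys ?orbT.
by rewrite inE => /predU1P[->|]//; exact: H2.
Qed.

(** Sites are listed without repetition because the product formula is given for such lists only. *)
Definition cylinders : set (set environment) :=
  [set C | exists s B, uniq s /\ C = cylinder s B].

Lemma cylinders_setI : setI_closed cylinders.
Proof.
move=> _ _ [s [B [us ->]]] [t [C [ut ->]]].
(* Each constraint is imposed only at the sites of its own list. *)
exists (undup (s ++ t)),
  (fun z => [set a | (z \in s -> B z a) /\ (z \in t -> C z a)]).
rewrite undup_uniq; split=> //; apply/seteqP; split=> [G [H1 H2] z _|G H].
  by split; [exact: H1|exact: H2].
by split=> z zs; have [] := H z; rewrite ?mem_undup ?mem_cat ?zs ?orbT //; auto.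
Qed.

Lemma measurable_cylindersE : @measurable _ environment = <<s cylinders >>.
Proof.
apply/seteqP; split; apply: smallest_sub; try exact: smallest_sigma_algebra.
  move=> _ [z [B mB ->]]; apply: sub_gen_smallest; exists [:: z], (fun=> B).
  split=> //; apply/seteqP; split=> [G H y|G]; last by apply; rewrite inE.
  by rewrite inE => /eqP ->.
by move=> _ [s [B [_ ->]]]; exact: measurable_cylinder.
Qed.

Lemma cylinder_measure s B : uniq s ->
  nu (cylinder s B) = (\prod_(z <- s) fine (mu (B z)))%:E.
Proof. by move=> us; exact: nu_product. Qed.

Definition shift (v : Z2) (G : environment) : environment := fun z => G (z + v).

Lemma shift_cylinder v s B : shift v @^-1` cylinder s B =
  cylinder [seq z + v | z <- s] (fun z => B (z - v)).
Proof.
apply/seteqP; split=> G H z; first by case/mapP => y ys ->; rewrite addrK; exact: H.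
by move=> zs; have := H (z + v) (map_f _ zs); rewrite addrK.
Qed.

Lemma measurable_shift v : measurable_fun setT (shift v).
Proof.
apply: (measurability _ measurable_cylindersE) => _ [_ [s [B [_ ->]]] <-].
by rewrite setTI shift_cylinder; exact: measurable_cylinder.
Qed.

Lemma measurable_shift_preimage v A : measurable A -> measurable (shift v @^-1` A).
Proof. by move=> mA; rewrite -[_ @^-1` _]setTI; exact: measurable_shift. Qed.

(** All marginals equal [mu], so the shifted measure agrees with [nu] on cylinders, a generating
    pi-system. *)
Lemma nu_shift v A : measurable A -> nu (shift v @^-1` A) = nu A.
Proof.
move=> mA; rewrite -[LHS]/(pushforward nu (shift v) A).
apply: (measure_unique cylinders (fun=> setT)) => //.
- exact: measurable_cylindersE.
- exact: cylinders_setI.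
- by move=> _; exists [::], (fun=> setT); split => //; apply/seteqP; split.
- by apply/seteqP; split=> // G _; exists 0%N.
- exact: measurable_shift.
- move=> ? _ [s [B [us ->]]]; rewrite /= /pushforward shift_cylinder.
  rewrite !cylinder_measure ?big_map; last first.
    by rewrite map_inj_uniq //; exact: addIr.
    done.
  by congr (_%:E); apply: eq_bigr => z _; rewrite addrK.
- by move=> ? _; rewrite /= /pushforward preimage_setT probability_setT ltry.
Qed.

Lemma near_all_seq (T : eqType) (s : seq T) (P : T -> nat -> Prop) :
  (forall t, t \in s -> \forall n \near \oo, P t n) ->
  \forall n \near \oo, forall t, t \in s -> P t n.
Proof.
elim: s => [|t s IH] H; first by near=> n.
have Ht : \forall n \near \oo, P t n by apply: H; rewrite inE eqxx.
have Hs : \forall n \near \oo, forall t', t' \in s -> P t' n.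
  by apply: IH => t' ts; apply: H; rewrite inE ts orbT.
near=> n => t'; rewrite inE => /predU1P[->|]; first by near: n.
by move: t'; near: n.
Unshelve. all: by end_near. Qed.

(** By injectivity each pair of sites collides for at most one [n], and there are finitely many
    pairs. *)
Lemma near_translates_disjoint (v : Z2) (s t : seq Z2) :
  injective (GRing.natmul v) ->
  \forall n \near \oo, forall z, z \in t -> z + v *+ n \notin s.
Proof.
move=> injv; apply: near_all_seq => z _.
suff : \forall n \near \oo, forall y, y \in s -> z + v *+ n <> y.
  by apply: filterS => n H; apply/negP => /H; exact.
apply: near_all_seq => y _.
have [[m <-]|H] := pselect (exists m, z + v *+ m = y); last first.
  by near=> n => e; apply: H; exists n.
near=> n => /addrI/injv e.
suff : (m < n)%N by rewrite e ltnn.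
by near: n; exists m.+1.
Unshelve. all: by end_near. Qed.

(** Once the two sets of sites are disjoint, the intersection is a single cylinder and its measure
    factors exactly, so the sequence is eventually constant. *)
Lemma cylinder_independence v s B t C : injective (GRing.natmul v) ->
  uniq s -> uniq t ->
  fine (nu (cylinder s B `&` shift (v *+ n) @^-1` cylinder t C)) @[n --> \oo]
    --> fine (nu (cylinder s B)) * fine (nu (cylinder t C)).
Proof.
move=> injv us ut; apply: cvg_near_cst.
apply: filterS (near_translates_disjoint v s t injv) => n dn.
rewrite shift_cylinder.
set t' := [seq _ | _ <- _].
pose D z := if z \in s then B z else C (z - v *+ n).
have nts z : z \in t' -> z \in s = false.
  by case/mapP => y yt ->; apply/negbTE/dn.
have ust : uniq (s ++ t').
  rewrite cat_uniq us map_inj_uniq ?ut ?andbT; last exact: addIr.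
  by apply/hasPn => z /nts ->.
have -> : cylinder s B `&` cylinder t' (fun z => C (z - v *+ n)) =
    cylinder (s ++ t') D.
  apply/seteqP; split=> [G [H1 H2] z|G H].
    rewrite mem_cat /D; case: ifPn => [zs _|_ /= zt]; first exact: H1.
    exact: H2.
  split=> z zs; have := H z; rewrite mem_cat zs ?orbT /D => /(_ isT).
    by rewrite zs.
  by rewrite nts.
rewrite !cylinder_measure //= big_cat big_map /=; congr (_ * _).
  by apply: eq_big_seq => z zs; rewrite /D zs.
by apply: eq_big_seq => z zs; rewrite /D (negbTE (dn _ zs)) addrK.
Qed.

(** The passage from cylinders to measurable events is made twice, once in each argument. *)
Lemma shift_mixing v A C : injective (GRing.natmul v) ->
  measurable A -> measurable C ->
  fine (nu (A `&` shift (v *+ n) @^-1` C)) @[n --> \oo]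
    --> fine (nu A) * fine (nu C).
Proof.
move=> injv mA mC.
have mS w B : measurable B -> measurable (shift w @^-1` B).
  exact: measurable_shift_preimage.
have step1 B s D : measurable B -> uniq s ->
    fine (nu (B `&` shift (v *+ n) @^-1` cylinder s D)) @[n --> \oo]
      --> fine (nu B) * fine (nu (cylinder s D)).
  move=> mB us; have mD := measurable_cylinder s D.
  apply: (asymptotic_independence _ _ _ _ cylinders
    (fun n => shift (v *+ n) @^-1` cylinder s D)) => //.
  - exact: measurable_cylindersE.
  - exact: cylinders_setI.
  - by move=> n; exact: mS.
  - by under eq_fun do rewrite nu_shift //; exact: cvg_cst.
  - by move=> _ [t [E [ut ->]]]; exact: cylinder_independence.
(* Invariance under the opposite shift exchanges the fixed and the moving event, so that the second
   argument can be generalised too. *)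
have flip n D : measurable D -> nu (A `&` shift (v *+ n) @^-1` D) =
    nu (D `&` shift (- (v *+ n)) @^-1` A).
  move=> mD; rewrite -(nu_shift (- (v *+ n))); last first.
    by apply: measurableI => //; exact: mS.
  rewrite preimage_setI setIC -comp_preimage; congr (nu (_ `&` _)).
  rewrite (_ : _ \o _ = id) //; apply/funext => G; apply/funext => z.
  by rewrite /shift /= addrK.
under eq_fun do rewrite flip //.
rewrite mulrC.
apply: (asymptotic_independence _ _ _ _ cylinders
    (fun n => shift (- (v *+ n)) @^-1` A)) => //.
- exact: measurable_cylindersE.
- exact: cylinders_setI.
- by move=> n; exact: mS.
- by under eq_fun do rewrite nu_shift //; exact: cvg_cst.
- move=> _ [t [E [ut ->]]]; have mE := measurable_cylinder t E.
  under eq_fun do rewrite -flip //.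
  by rewrite mulrC; exact: step1.
Qed.

Lemma nu_coordinate z (S : set stepset) :
  nu [set G : environment | S (G z)] = mu S.
Proof.
have -> : [set G : environment | S (G z)] = cylinder [:: z] (fun=> S).
  apply/seteqP; split=> G H; last by apply: H; rewrite inE.
  by move=> y; rewrite inE => /eqP ->.
by rewrite cylinder_measure // big_seq1 fineK // fin_num_measure.
Qed.

Lemma ae_coordinate z (S : set stepset) : mu S = 1%E ->
  {ae nu, forall G : environment, S (G z)}.
Proof.
move=> S1; have mS := measurable_coordinate z S.
exists (~` [set G : environment | S (G z)]); split=> //; first exact: measurableC.
by rewrite probability_setC // nu_coordinate S1 subee.
Qed.

Lemma ae_forall_countable d (T : measurableType d) (P : {measure set T -> \bar R})
    (I : countType) (Q : I -> T -> Prop) :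
  (forall i, {ae P, forall t, Q i t}) -> {ae P, forall t, forall i, Q i t}.
Proof.
move=> aeQ; pose Q' n t := if unpickle n is Some i then Q i t else True.
have /ae_foralln : forall n, {ae P, forall t, Q' n t}.
  by move=> n; rewrite /Q'; case: unpickle => [i|]; [exact: aeQ|exact: aeW].
by apply: filterS => t H i; have := H (pickle i); rewrite /Q' pickleK.
Qed.

(** Missing [S] at the first [m] sites of the ray, which are distinct, has probability [r ^+ m] with
    [r < 1]. *)
Lemma ae_ray_hits (z v : Z2) (S : set stepset) : injective (GRing.natmul v) ->
  (0 < mu S)%E -> {ae nu, forall G : environment, exists n, S (G (z + v *+ n))}.
Proof.
move=> injv S0; pose s m := [seq z + v *+ n | n <- iota 0 m].
have us m : uniq (s m).
  by rewrite map_inj_uniq ?iota_uniq // => i j /addrI /injv.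
pose N : set environment := \bigcap_m cylinder (s m) (fun=> ~` S).
have mN : measurable N.
  by apply: bigcapT_measurable => m; exact: measurable_cylinder.
pose r := fine (mu (~` S)).
have r0 : 0 <= r by exact: fine_ge0.
have r1 : r < 1.
  rewrite /r probability_setC //.
  move: S0 (probability_le1 mu (I : measurable S)).
  have : mu S \is a fin_num by exact: fin_num_measure.
  by case: (mu S) => // q _; rewrite !lte_fin lee_fin /=; lra.
exists N; split=> //; last first.
  move=> G /= /forallNP H m _ y /mapP[n _ ->]; exact: H.
have le m : fine (nu N) <= r ^+ m.
  have -> : r ^+ m = fine (nu (cylinder (s m) (fun=> ~` S))).
    by rewrite cylinder_measure //= big_const_seq count_predT size_map size_iota
      iter_mulr_1.
  apply: fine_probability_le => //; first exact: measurable_cylinder.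
  exact: bigcap_inf.
have : fine (nu N) <= 0.
  have cr : r ^+ n @[n --> \oo] --> 0 by apply: cvg_expr; rewrite ger0_norm.
  by apply: (cvgr_to_ge cr); near=> m; exact: le.
move=> h; rewrite -[LHS]fineK ?fin_num_measure //; congr (_%:E).
by apply/eqP; rewrite eq_le h fine_ge0.
Unshelve. all: by end_near. Qed.

End Environments.

(** * Multiples of steps and measurability of the cluster events *)

Lemma mulrnZ2 (v : Z2) n : v *+ n = (v.1 * n%:Z, v.2 * n%:Z).
Proof.
elim: n => [|n IH]; first by rewrite mulr0n !mulr0.
by rewrite mulrSr IH; congr pair; rewrite /= -[n.+1]addn1 PoszD mulrDr mulr1.
Qed.

Lemma natmul_step_inj v : v \in steps -> injective (GRing.natmul v).
Proof.
by move=> /stepsP[] -> m n; rewrite !mulrnZ2 /= => -[]; lia.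
Qed.

Lemma measurable_exists d (T : measurableType d) (I : countType) (Q : I -> T -> Prop) :
  (forall i, measurable [set t | Q i t]) -> measurable [set t | exists i, Q i t].
Proof.
move=> mQ; rewrite (_ : [set _ | _] = \bigcup_i [set t | Q i t]).
  exact: countable_bigcupT_measurable.
by apply/seteqP; split=> t [i]; [exists i|exists i].
Qed.

Lemma measurable_forall d (T : measurableType d) (I : countType) (Q : I -> T -> Prop) :
  (forall i, measurable [set t | Q i t]) -> measurable [set t | forall i, Q i t].
Proof.
move=> mQ.
rewrite (_ : [set _ | _] = ~` [set t | exists i, ~ Q i t]).
  by apply/measurableC/measurable_exists => i; exact: measurableC (mQ i).
apply/seteqP; split=> t /=; first by move=> H [i nQ]; exact: nQ (H i).
by move=> /forallNP H i; exact: contrapT (H i).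
Qed.

Lemma measurable_dirs z d : measurable [set G : environment | dirs (G z) d].
Proof. exact: (measurable_coordinate z [set A | dirs A d]). Qed.

(** Paths range over an uncountable type; recursion on the length replaces them by quantifiers over
    single steps in [Z2], which is countable. *)
Lemma measurable_reaches y z : measurable [set G : environment | reaches G y z].
Proof.
pose r := fix r n y (G : environment) := if n is n'.+1 then
  exists d, dirs (G y) d /\ r n' (y + d) G else y = z.
have mr n : forall y, measurable [set G | r n y G].
  elim: n => [|n IH] {}y /=.
    have [->|e] := eqVneq y z; first by rewrite (_ : [set _ | _] = setT) //; apply/seteqP.
    rewrite (_ : [set _ | _] = set0) //; apply/seteqP; split=> // G /= yz.
    by rewrite yz eqxx in e.
  apply: measurable_exists => d.
  by apply: measurableI; [exact: measurable_dirs|exact: IH].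
rewrite (_ : [set _ | _] = [set G | exists n, r n y G]).
  by apply: measurable_exists => n.
apply/seteqP; split=> G /=.
  elim/reaches_ind: y / => [|y d yd _ [n rn]]; first by exists 0%N.
  by exists n.+1, d.
case=> n; elim: n y => [|n IH] y /= => [->|[d [yd /IH]]].
  exact: reaches_refl.
exact: reaches_step.
Qed.

Lemma measurable_full x :
  measurable [set G : environment | backward_cluster G x = setT].
Proof.
rewrite (_ : [set _ | _] = [set G | forall y, reaches G y x]).
  by apply: measurable_forall => y; exact: measurable_reaches.
apply/seteqP; split=> [G /= H y|G /= H].
  by rewrite -[reaches _ y x]/(backward_cluster G x y) H.
by rewrite -subTset => y _; exact: H.
Qed.

(** The quantifier over functions [W] is uncountable, so the height is chosen column by column;
    blocking then follows from [below_blocking]. *)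
Lemma measurable_below x : measurable [set G : environment | exists2 W : int -> int,
   upper_blocking G W & backward_cluster G x = below W].
Proof.
rewrite (_ : [set _ | _] = [set G | forall a : int, exists w : int, forall b : int,
    reaches G (a, b) x <-> b <= w]).
  apply: measurable_forall => a; apply: measurable_exists => w.
  apply: measurable_forall => b; have mr := measurable_reaches (a, b) x.
  have [h|h] := boolP (b <= w).
    by rewrite (_ : [set _ | _] = [set G | reaches G (a, b) x]) //;
      apply/seteqP; split=> G /= H; [exact: H.2|split].
  rewrite (_ : [set _ | _] = ~` [set G | reaches G (a, b) x]).
    exact: measurableC.
  apply/seteqP; split=> G /= H; first by move=> /H.
  by split.
apply/seteqP; split=> G /=.
  by move=> [W _ BW] a; exists (W a) => b; rewrite -[reaches _ _ _]/(backward_cluster G x (a, b)) BW.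
move=> /choice[W HW].
have BW : backward_cluster G x = below W by apply/seteqP; split=> -[a b]; rewrite /below /= -HW.
by exists W => //; exact: below_blocking BW.
Qed.

Lemma reaches_shift v G y z :
  reaches (shift v G) y z <-> reaches G (y + v) (z + v).
Proof.
split=> [|yz].
  elim/reaches_ind: y / => [|y d yd _ IH]; first exact: reaches_refl.
  by apply: (reaches_step G _ d) => //; rewrite addrAC.
rewrite -(addrK v y); move: (y + v) yz => {}y.
elim/reaches_ind: y / => [|y d yd _ IH]; first by rewrite addrK; exact: reaches_refl.
apply: (reaches_step _ _ d); first by rewrite /shift subrK.
by rewrite addrAC.
Qed.

(** * Almost sure regularity and the exclusion of (ii) against (iii) *)

Section Main.
Context (R : realType) (mu : probability stepset R) (nu : probability environment R).
Hypothesis nu_product : is_product_measure mu nu.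

Lemma ae_regular :
  mu [set A | dirs A `&` [set e2; e1] !=set0] = 1%E ->
  mu [set A | dirs A `&` [set e2; - e1] !=set0] = 1%E ->
  (forall e : Z2, e \in steps -> e <> - e2 -> (0 < mu [set A | dirs A e])%E) ->
  {ae nu, forall G, regular G}.
Proof.
move=> NE NW pos.
have aeN S : mu S = 1%E -> {ae nu, forall G : environment, forall z, S (G z)}.
  by move=> S1; apply: ae_forall_countable => z; exact: ae_coordinate S1.
have aeR : {ae nu, forall G : environment, forall t : Z2 * Z2 * Z2,
    t.1.1 \in steps -> t.1.1 <> - e2 -> t.1.2 \in steps ->
    exists n, dirs (G (t.2 + t.1.2 *+ n)) t.1.1}.
  apply: ae_forall_countable => -[[d v] z] /=.
  have [[ds [de vs]]|h] := pselect (d \in steps /\ d <> - e2 /\ v \in steps); last first.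
    by apply: aeW => G ds de vs; case: h.
  have /(_ z) := ae_ray_hits _ _ _ nu_product _ v [set A | dirs A d] (natmul_step_inj _ vs) (pos _ ds de).
  by apply: filterS.
have aeE := aeN _ NE; have aeW' := aeN _ NW.
move: aeE aeW' aeR; apply: filterS3 => G HE HW HR; split=> [z|d v z]; last exact: (HR (d, v, z)).
have [up|nup] := pselect (dirs (G z) e2); first by left.
right; have [d [hd [ed|ed]]] := HE z; first by rewrite ed in hd.
have [d' [hd' [ed'|ed']]] := HW z; first by rewrite ed' in hd'.
by split; [rewrite -ed|rewrite -ed'].
Qed.

Lemma full_below_exclusive x :
  ~ ((0 < nu [set G | backward_cluster G x = setT])%E /\
     (0 < nu [set G | exists2 W : int -> int,
        upper_blocking G W & backward_cluster G x = below W])%E).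
Proof.
set F := [set G | _ = setT]; set H := [set G | exists2 W, _ & _].
move=> [F0 H0].
have mF : measurable F by exact: measurable_full.
have mH : measurable H by exact: measurable_below.
have := shift_mixing _ _ _ nu_product (- e2) H F (natmul_step_inj (- e2) isT) mH mF.
(* On [H] the site [x - n e2] leads to [x]; if its own cluster were the whole plane, so would be
   that of [x], yet [(x.1, W x.1 + 1)] is not below [W]. *)
have -> : (fun n => fine (nu (H `&` shift (- e2 *+ n) @^-1` F))) = (fun=> 0).
  apply/funext => n; rewrite (_ : _ `&` _ = set0) ?measure0 //.
  apply/seteqP; split=> // G [[W _ BW]].
  rewrite /F /= => full.
  have dE : - e2 *+ n = (0, - n%:Z) by rewrite mulrnZ2 /=; congr pair; lia.
  have dx : reaches G (x + - e2 *+ n) x.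
    rewrite -[reaches _ _ _]/(backward_cluster G x _) BW /below /= dE /=.
    have : below W x by rewrite -BW; exact: reaches_refl.
    by rewrite /below /= addr0; lia.
  have : below W (x.1, W x.1 + 1).
    rewrite -BW; apply: reaches_trans dx.
    have : backward_cluster (shift (- e2 *+ n) G) x ((x.1, W x.1 + 1) - - e2 *+ n).
      by rewrite full.
    by move/reaches_shift; rewrite subrK.
  by rewrite /below /=; lia.
(* Mixing identifies the limit 0 with the product of the two probabilities. *)
move=> /(cvg_unique (@norm_hausdorff _ _) (@cvg_cst _ _ _ _ _))/esym/eqP.
rewrite mulf_eq0 => /orP[] /eqP e.
  by move: H0; rewrite -[nu H]fineK ?fin_num_measure // e ltxx.
by move: F0; rewrite -[nu F]fineK ?fin_num_measure // e ltxx.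
Qed.


End Main.

Theorem corollary3p10 (R : realType)
    (mu : probability stepset R) (nu : probability environment R)
    (nu_product : is_product_measure mu nu)
    (mu_NE : mu [set A | dirs A `&` [set e2; e1] !=set0] = 1%E)
    (mu_NW : mu [set A | dirs A `&` [set e2; - e1] !=set0] = 1%E)
    (mu_pos : forall e : Z2, e \in steps -> e <> - e2 ->
       (0 < mu [set A | dirs A e])%E)
    (x : Z2) :
  [/\ {ae nu, forall G : environment,
        [\/ finite_set (backward_cluster G x),
            backward_cluster G x = setT
          | exists2 W : int -> int,
              upper_blocking G W & backward_cluster G x = below W]},
      ~ ((0 < nu [set G | backward_cluster G x = setT])%E /\
         (0 < nu [set G | exists2 W : int -> int,
              upper_blocking G W & backward_cluster G x = below W])%E)
    & {ae nu, forall G : environment, forall y z : Z2,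
        infinite_set (backward_cluster G y) ->
        infinite_set (backward_cluster G z) ->
        infinite_set (backward_cluster G y `&` backward_cluster G z)}].
Proof.
have aereg := ae_regular _ _ _ nu_product mu_NE mu_NW mu_pos.
split; last 1 first.
- by apply: filterS aereg => G regG y z; exact: infinite_clusters_meet.
- by apply: filterS aereg => G regG; exact: cluster_trichotomy.
- exact: full_below_exclusive nu_product x.
Qed.
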